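(* Let $q$ be a prime power and let $S\subseteq\mathrm{PG}(3,q)$ be a set of $q^2+q+t$ points, where $2<t\le q+1$, such that every plane of $\mathrm{PG}(3,q)$ meets $S$ in $0$, $q+2$ or $q+t$ points. Then: (i) no line meets $S$ in exactly one point; (ii) through every point of $S$ there are exactly $q^2+q$ lines meeting $S$ in exactly $2$ points and exactly one line meeting $S$ in exactly $t$ points; (iii) every plane through a line meeting $S$ in exactly $t$ points meets $S$ in exactly $q+t$ points; (iv) through every line meeting $S$ in exactly $2$ points there is exactly one plane meeting $S$ in $q+t$ points, and all other planes through it meet $S$ in $q+2$ points; (v) every plane meeting $S$ in $q+2$ points meets it in a hyperoval of that plane; (vi) $q=2^n$ for some positive integer $n$; (vii) the set of values $|\ell\cap S|$, $\ell$ a line, is exactly $\{0,2,t\}$; (viii) if $\pi$ is a plane meeting $S$ in $q+t$ points, then $S\cap\pi$ is a KM-arc of type $t$ in $\pi$; (ix) $t=2^i$ for some $i\le n$.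
   Context: A hyperoval of a projective plane $\mathrm{PG}(2,q)$ is a set of $q+2$ points no three of which are collinear. A KM-arc of type $t$ in a projective plane $\mathrm{PG}(2,q)$ is a set of $q+t$ points such that the set of sizes of its intersections with the lines of the plane is exactly $\{0,2,t\}$. *)

(* Defs.v *)
From HB Require Import structures.
From mathcomp Require Export all_boot all_order all_algebra.

Set Implicit Arguments.
Unset Strict Implicit.
Unset Printing Implicit Defensive.

(* Over a finite field, subspaces are canonical (row-reduced) matrices, hence
   form a finite type; the library only declares the choiceType structure. *)
Import VectorInternalTheory.
HB.instance Definition _ (F : finFieldType) (V : vectType F) :=
  [Countable of {vspace V} by <:].
HB.instance Definition _ (F : finFieldType) (V : vectType F) :=
  [Finite of {vspace V} by <:].

(* The subspaces of projective dimension k of the projective space of V. *)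
Notation pgsub V k := {U : {vspace V} | \dim U == k.+1}.
Notation pgpoint V := (pgsub V 0).
Notation pgline V := (pgsub V 1).
Notation pgplane V := (pgsub V 2).

(* PG(n, q) for q = #|F| is the projective space of this vector space. *)
Notation PG n F := 'rV[F]_(n.+1).

Section Incidence.

Variables (F : finFieldType) (V : vectType F).

Definition incident j k (A : pgsub V j) (B : pgsub V k) : bool :=
  (val A <= val B)%VS.

Definition meet (S : {set pgpoint V}) k (B : pgsub V k) : {set pgpoint V} :=
  [set p in S | incident p B].

(* The projective plane attached to P has as points and lines those of the
   ambient space that are incident with P. *)
Definition hyperoval (P : pgplane V) (A : {set pgpoint V}) : Prop :=
  [/\ forall p, p \in A -> incident p P,
      #|A| = #|F| + 2
    & forall x y z, x \in A -> y \in A -> z \in A ->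
        x != y -> x != z -> y != z ->
        ~ exists L : pgline V,
            [/\ incident L P, incident x L, incident y L & incident z L]].

Definition KM_arc (t : nat) (P : pgplane V) (A : {set pgpoint V}) : Prop :=
  [/\ forall p, p \in A -> incident p P,
      #|A| = #|F| + t
    & forall m : nat,
        (exists L : pgline V, incident L P /\ #|meet A L| = m)
        <-> m \in [:: 0; 2; t]].

End Incidence.

(* Main.v *)
Require Import Defs.
From mathcomp Require Import all_field zify.

(* Let [L] be a line with [x > 0] points of [S], on [a] planes of size [q + t].
   Counting [S] over the planes through [L] gives
   [q (x - 2) = (a - 1) (t - 2)]: so [x <> 1], [a = 1] iff [x = 2],
   and [a = q + 1] if [x = t].
   Since there are no tangents, for a point [p] of [S] the excesses [x - 2] of
   the lines on [p] are nonnegative; they sum to [t - 2] over all lines on [p],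
   to [t - 2] over those in a plane of size [q + t], and to [0] over those in a
   plane of size [q + 2].  Hence every line on [p] with [x > 2] lies in every
   plane of size [q + t] on [p]; as such a line is on at least two such planes,
   it is unique, and therefore has [x = t].
   A point off [S] in a plane of size [q + 2] shows that [q] is even, and the
   [t]-secants in a plane of size [q + t] partition its points of [S], so
   [t] divides [q]. *)

Set Implicit Arguments.
Unset Strict Implicit.
Unset Printing Implicit Defensive.

(** * Pencils of subspaces and counting along them *)

Section Pencils.

Variables (F : finFieldType) (V : vectType F).
Implicit Types (U W : {vspace V}) (S : {set pgpoint V}) (k : nat).

(** The counts below take [\dim U = k], so that for [U] inside [W] the members correspond to the
    points of the projective space of W/U. *)
Definition pencil U W k : {set pgsub V k} :=
  [set X : pgsub V k | (U <= val X)%VS && (val X <= W)%VS].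

Lemma in_pencil U W k (X : pgsub V k) :
  (X \in pencil U W k) = (U <= val X)%VS && (val X <= W)%VS.
Proof. by rewrite inE. Qed.

Lemma in_star j k (A : pgsub V j) (X : pgsub V k) :
  (X \in pencil (val A) fullv k) = incident A X.
Proof. by rewrite in_pencil subvf andbT. Qed.

Lemma in_pencil_sub j k l (A : pgsub V j) (B : pgsub V l) (X : pgsub V k) :
  (X \in pencil (val A) (val B) k) = incident A X && incident X B.
Proof. exact: in_pencil. Qed.

(** The only candidate is [U + <[v]>], of dimension [k.+1] because [v] lies outside [U]. *)
Lemma card_pencil_vector U W k (v : V) :
    \dim U = k -> (U <= W)%VS -> v \in W -> v \notin U ->
  #|[set X in pencil U W k | v \in val X]| = 1.
Proof.
move=> dimU sUW Wv U'v.
have v0: (v != 0)%R by apply: contraNneq U'v => ->; rewrite mem0v.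
have dimUv: \dim (U + <[v]>) == k.+1.
  rewrite eqn_leq -{1}addn1 -dimU.
  have := (dimv_add_leqif U <[v]>).1; rewrite dim_vline v0 => -> /=.
  rewrite (ltn_leqif (dimv_leqif_sup (addvSl U <[v]>))).
  by apply: contra U'v; rewrite subv_add -memvE => /andP[].
pose Uv : pgsub V k := exist (fun X => \dim X == k.+1) _ dimUv.
apply/eqP/cards1P; exists Uv.
apply/setP=> X; rewrite !inE -val_eqE /= eq_sym eqEdim.
rewrite (eqP dimUv) (eqP (valP X)) leqnn andbT subv_add -memvE andbAC.
rewrite andb_idr // => /andP[sUX Xv].
suff /eqP <-: (U + <[v]> == val X)%VS by rewrite subv_add sUW -memvE.
by rewrite eqEdim (eqP dimUv) (eqP (valP X)) leqnn andbT subv_add -memvE sUX.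
Qed.

(** Double counting with [card_pencil_vector]. The family [f] lets one count serve both for vectors
    and for projective points, each represented by a spanning vector. *)
Lemma sum_pencil (I : finType) (f : I -> V) (A : {set I}) U W k :
    \dim U = k -> (U <= W)%VS ->
  \sum_(X in pencil U W k)
     #|[set i in A | (f i \in val X) && (f i \notin U)]|
  = #|[set i in A | (f i \in W) && (f i \notin U)]|.
Proof.
move=> dimU sUW.
under eq_bigr => X _ do rewrite -sum1_card big_mkcond /=.
rewrite exchange_big /= -sum1_card [RHS]big_mkcond /=.
apply: eq_bigr => i _; rewrite !inE.
have [Ai|A'i] := boolP (i \in A); last first.
  by rewrite big1 // => X _; rewrite !inE (negPf A'i).
have [iU|iU'] := boolP (f i \in U).
  by rewrite andbF big1 // => X _; rewrite !inE iU !andbF.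
have [iW|iW'] := boolP (f i \in W); last first.
  rewrite big1 // => X; rewrite in_pencil => /andP[_ sXW]; rewrite !inE.
  by case: ifP => // /and3P[_ /(subvP sXW) iW]; rewrite iW in iW'.
rewrite -big_mkcondr -[RHS](card_pencil_vector dimU sUW iW iU') -sum1_card.
by apply: eq_bigl => X; rewrite !inE Ai iU' andbT.
Qed.

Lemma sub_pgpoint (p : pgpoint V) U : (val p <= U)%VS = (vpick (val p) \in U).
Proof.
have p0 : (vpick (val p) != 0)%R by rewrite vpick0 -dimv_eq0 (eqP (valP p)).
rewrite [in RHS]memvE; congr (_ <= U)%VS; apply/esym/eqP.
by rewrite eqEdim -memvE memv_pick dim_vline p0 (eqP (valP p)).
Qed.

Lemma sum_pencil_points S U W k : \dim U = k -> (U <= W)%VS ->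
  \sum_(X in pencil U W k)
     #|[set p in S | (val p <= val X)%VS && ~~ (val p <= U)%VS]|
  = #|[set p in S | (val p <= W)%VS && ~~ (val p <= U)%VS]|.
Proof.
move=> dimU sUW; pose f (p : pgpoint V) := vpick (val p).
have pickE X : [set p in S | (val p <= X)%VS && ~~ (val p <= U)%VS]
    = [set p in S | (f p \in X) && (f p \notin U)].
  by apply/setP=> p; rewrite !inE !sub_pgpoint.
by rewrite pickE -(sum_pencil f S dimU sUW); under eq_bigr do rewrite pickE.
Qed.

Lemma card_vspace_finvect U :
  #|[set v : finvect_type V | v \in U]| = #|F| ^ \dim U.
Proof.
case: V U => T cT U; rewrite cardsE.
exact: (@card_vspace F (finvect_type (Vector.Pack cT)) cT U).
Qed.

(** The members partition the vectors of [W] outside [U] into classes of equal size. The product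
    form avoids a division. *)
Lemma card_pencil U W k : \dim U = k -> (U <= W)%VS ->
  #|pencil U W k| * (#|F| ^ k.+1 - #|F| ^ k) = #|F| ^ \dim W - #|F| ^ k.
Proof.
move=> dimU sUW; pose T : finType := finvect_type V.
have cardD (X : {vspace V}) : (U <= X)%VS ->
    #|[set v in [set: T] | (v \in X) && (v \notin U)]|
    = #|F| ^ \dim X - #|F| ^ k.
  move=> sUX; rewrite -dimU.
  rewrite -!card_vspace_finvect -cardsDS.
    by apply: eq_card => v; rewrite !inE /= andbC.
  by apply/subsetP=> v; rewrite !inE => /(subvP sUX).
rewrite -cardD // -(sum_pencil _ _ dimU sUW) -sum_nat_const.
apply: eq_bigr => X; rewrite in_pencil => /andP[sUX _].
by rewrite cardD // (eqP (valP X)).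
Qed.

Lemma meet_incidentS S j k (A : pgsub V j) (B : pgsub V k) :
  incident A B -> meet S A \subset meet S B.
Proof.
move=> AB; apply/subsetP=> p; rewrite !inE => /andP[-> pA].
exact: subv_trans pA AB.
Qed.

Lemma meet_meet S j k (A : pgsub V j) (B : pgsub V k) :
  incident A B -> meet (meet S B) A = meet S A.
Proof.
move=> AB; apply/setP=> p; rewrite !inE -andbA; congr (_ && _).
by apply: andb_idl => pA; apply: subv_trans pA AB.
Qed.

End Pencils.

(** * Incidence counts in PG(3, q) *)

Section ProjectiveSpace.

Variables (F : finFieldType) (S : {set pgpoint (PG 3 F)}).
Let q := #|F|.
Implicit Types (p : pgpoint (PG 3 F)) (L : pgline (PG 3 F)).
Implicit Types (P : pgplane (PG 3 F)).

(** W/U has dimension 2, so the members form a projective line. The cases k = 0, 1, 2 are points on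
    a line, lines of a plane through a point, and planes on a line. *)
Lemma card_pencil_dim2 U W k : \dim U = k -> \dim W = k.+2 -> (U <= W)%VS ->
  #|@pencil F (PG 3 F) U W k| = q + 1.
Proof.
move=> dimU dimW sUW; have := card_pencil dimU sUW.
have q1 : 1 < q := finNzRing_gt1 F.
rewrite dimW -/q; have <- : (q + 1) * (q ^ k.+1 - q ^ k) = q ^ k.+2 - q ^ k.
  by rewrite !expnS; nia.
by move/eqP; rewrite eqn_pmul2r ?subn_gt0 ?ltn_exp2l // => /eqP.
Qed.

Lemma card_points_line L : #|[set p : pgpoint (PG 3 F) | incident p L]| = q + 1.
Proof.
rewrite -(card_pencil_dim2 (dimv0 _) (eqP (valP L)) (sub0v _)).
by apply: eq_card => p; rewrite in_pencil inE sub0v.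
Qed.

Lemma card_lines_point_plane p P : incident p P ->
  #|pencil (val p) (val P) 1| = q + 1.
Proof. exact: card_pencil_dim2 (eqP (valP p)) (eqP (valP P)). Qed.

Lemma card_planes_line L : #|pencil (val L) fullv 2| = q + 1.
Proof. by apply: card_pencil_dim2 (eqP (valP L)) _ (subvf _); rewrite dimvf. Qed.

Lemma card_lines_point p : #|pencil (val p) fullv 1| = q ^ 2 + q + 1.
Proof.
have := card_pencil (eqP (valP p)) (subvf (val p)).
have q1 : 1 < q := finNzRing_gt1 F.
rewrite dimvf /dim /= -/q.
have <- : (q ^ 2 + q + 1) * (q ^ 2 - q ^ 1) = q ^ (1 * 4) - q ^ 1.
  by rewrite mul1n !expnS expn0; nia.
by move/eqP; rewrite eqn_pmul2r ?subn_gt0 ?ltn_exp2l // => /eqP.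
Qed.

(** Outside [A] the members partition the points of [W], while a point of [A] is counted once in
    every member. The summand on the left avoids a subtraction. *)
Lemma sum_pencil_meet k (A : pgsub (PG 3 F) k) W : (val A <= W)%VS ->
  \sum_(X in pencil (val A) W k.+1) #|meet S X| + #|meet S A|
  = #|[set p in S | (val p <= W)%VS]| + #|pencil (val A) W k.+1| * #|meet S A|.
Proof.
have split_card (X : {vspace PG 3 F}) : (val A <= X)%VS ->
    #|[set p in S | (val p <= X)%VS]| =
    #|[set p in S | (val p <= X)%VS && ~~ (val p <= val A)%VS]| + #|meet S A|.
  move=> sAX; rewrite -(cardsID (meet S A)) addnC; congr (_ + _).
    by apply: eq_card => p; rewrite !inE; case: (p \in S); rewrite ?andbF // andbC.
  apply: eq_card => p; rewrite !inE andb_idl // => /andP[-> pA].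
  exact: subv_trans pA sAX.
move=> sAW; rewrite split_card // -(sum_pencil_points S (eqP (valP A)) sAW).
rewrite addnAC; congr (_ + _); rewrite -sum_nat_const -big_split /=.
by apply: eq_bigr => X; rewrite in_pencil => /andP[/split_card].
Qed.

Lemma card_meet_point p : #|meet S p| = (p \in S).
Proof.
have eqp r : incident r p = (r == p).
  by rewrite /incident -val_eqE eqEdim (eqP (valP p)) (eqP (valP r)) andbT.
case: (boolP (p \in S)) => pS.
  apply/eqP/cards1P; exists p; apply/setP=> r; rewrite !inE eqp.
  by apply: andb_idl => /eqP->.
apply/eqP; rewrite cards_eq0; apply/eqP/setP=> r; rewrite !inE eqp.
by apply: contraNF pS => /andP[rS /eqP <-].
Qed.

Lemma meetT : [set p in S | (val p <= fullv)%VS] = S.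
Proof. by apply/setP=> p; rewrite inE subvf andbT. Qed.

Lemma sum_lines_plane p P : incident p P ->
  \sum_(L in pencil (val p) (val P) 1) #|meet S L| = #|meet S P| + q * (p \in S).
Proof.
(* The ascribed type turns the set of points of [S] below [val P] into [meet S P] by conversion. *)
move=> pP; have : _ = #|meet S P| + _ := sum_pencil_meet pP.
by rewrite card_lines_point_plane // card_meet_point; case: (p \in S); lia.
Qed.

Lemma sum_lines p :
  \sum_(L in pencil (val p) fullv 1) #|meet S L| = #|S| + (q ^ 2 + q) * (p \in S).
Proof.
have := sum_pencil_meet (subvf (val p)).
by rewrite card_lines_point card_meet_point meetT; case: (p \in S); lia.
Qed.

Lemma sum_planes L :
  \sum_(P in pencil (val L) fullv 2) #|meet S P| = #|S| + q * #|meet S L|.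
Proof.
have := sum_pencil_meet (subvf (val L)).
rewrite card_planes_line meetT; lia.
Qed.

(** Distinct lines span at least vector dimension 3, so a plane containing both equals their
    span. *)
Lemma plane_of_two_lines L1 L2 P1 P2 : L1 != L2 ->
  incident L1 P1 -> incident L2 P1 -> incident L1 P2 -> incident L2 P2 ->
  P1 = P2.
Proof.
move=> neqL L1P1 L2P1 L1P2 L2P2.
have dim3 : 2 < \dim (val L1 + val L2).
  rewrite -[X in X < _](eqP (valP L1)) (ltn_leqif (dimv_leqif_sup (addvSl _ _))).
  apply: contra neqL; rewrite subv_add => /andP[_ sL2L1].
  by rewrite eq_sym -val_eqE eqEdim sL2L1 (eqP (valP L1)) (eqP (valP L2)).
have spanE P : incident L1 P -> incident L2 P -> (val L1 + val L2)%VS = val P.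
  move=> L1P L2P; apply/eqP; rewrite eqEdim (eqP (valP P)) dim3 andbT.
  by rewrite subv_add; apply/andP.
by apply: val_inj; rewrite -(spanE P1) // -(spanE P2).
Qed.

End ProjectiveSpace.

(** * Line sizes from the planes through a line *)

Section TwoPlaneCharacters.

Variables (q : nat) (F : finFieldType) (t : nat) (S : {set pgpoint (PG 3 F)}).
Hypothesis (hq : #|F| = q).
Hypothesis (ht : 2 < t <= q + 1).
Hypothesis (hS : #|S| = q ^ 2 + q + t).
Hypothesis (hplane : forall P : pgplane (PG 3 F),
  #|meet S P| \in [:: 0; q + 2; q + t]).
Implicit Types (p : pgpoint (PG 3 F)) (L : pgline (PG 3 F)).
Implicit Types (P : pgplane (PG 3 F)).

Local Notation big_planes L :=
  [set P : pgplane (PG 3 F) | incident L P & #|meet S P| == q + t].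

(** A point of [S] on [L] rules out size 0. The boolean used as a number makes the sizes summable
    over the pencil. *)
Lemma card_plane_on_line L P : 0 < #|meet S L| -> incident L P ->
  #|meet S P| = q + 2 + (t - 2) * (#|meet S P| == q + t).
Proof.
move=> L0 LP; have := subset_leq_card (meet_incidentS S LP).
by have := hplane P; rewrite !inE => /or3P[] /eqP->; lia.
Qed.

(** This is [q (x - 2) = (a - 1) (t - 2)], rearranged to avoid most truncated subtractions. *)
Lemma big_planes_eq L : 0 < #|meet S L| ->
  2 * q + 2 + #|big_planes L| * (t - 2) = t + q * #|meet S L|.
Proof.
move=> L0; have := sum_planes S L.
rewrite hS -mulnn hq (eq_bigr (fun P => q + 2 + (t - 2) * (#|meet S P| == q + t))).
  rewrite big_split /= sum_nat_const card_planes_line hq -big_distrr /=.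
  rewrite -big_mkcondr /= sum1_card.
  have -> : #|[pred P in pencil (val L) fullv 2 | #|meet S P| == q + t]|
      = #|big_planes L|.
    by apply: eq_card => P; rewrite !inE subvf andbT.
  set a := #|big_planes L|; set x := #|meet S L|; clearbody a x.
  nia.
by move=> P; rewrite in_star => LP; apply: card_plane_on_line LP.
Qed.

Lemma q_gt1 : 1 < q. Proof. by rewrite -hq finNzRing_gt1. Qed.

Lemma t_gt2 : 2 < t. Proof. by case/andP: ht. Qed.

(** For x = 1 the left side of [big_planes_eq] is at least 2q + 2, the right side at most 2q + 1. *)
Lemma no_tangent L : #|meet S L| <> 1.
Proof. by move=> L1; have := @big_planes_eq L; rewrite L1; nia. Qed.

Lemma line_ge2 p L : p \in S -> incident p L -> 2 <= #|meet S L|.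
Proof.
move=> pS pL; have : 0 < #|meet S L| by apply/card_gt0P; exists p; rewrite inE pS.
by have := @no_tangent L; lia.
Qed.

Lemma card_big_planes2 L : #|meet S L| = 2 -> #|big_planes L| = 1.
Proof. by move=> L2; have := @big_planes_eq L; rewrite L2; nia. Qed.

Lemma t_line_big L P : #|meet S L| = t -> incident L P -> #|meet S P| = q + t.
Proof.
move=> Lt LP; have := @big_planes_eq L; rewrite Lt => /(_ ltac:(lia)) e.
have cardE : #|big_planes L| = q + 1 by nia.
have /eqP bigE : big_planes L == pencil (val L) fullv 2.
  rewrite eqEcard card_planes_line hq cardE leqnn andbT.
  by apply/subsetP=> R; rewrite in_star inE => /andP[].
have : P \in big_planes L by rewrite bigE in_star.
by rewrite inE => /andP[_ /eqP].
Qed.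

Lemma big_plane_pair L : 2 < #|meet S L| ->
  exists P1 P2, [/\ P1 != P2, P1 \in big_planes L & P2 \in big_planes L].
Proof.
move=> L3; have /card_gt1P[P1 [P2 [h1 h2 h3]]] : 1 < #|big_planes L|.
  by have := @big_planes_eq L; nia.
by exists P1, P2.
Qed.

(** * Excesses of the lines through a point of [S] *)

(** The total is (q^2 + q + t) + (q^2 + q) - 2(q^2 + q + 1); each truncated difference is exact by
    [line_ge2]. *)
Lemma excess_lines p : p \in S ->
  \sum_(L in pencil (val p) fullv 1) (#|meet S L| - 2) = t - 2.
Proof.
move=> pS; have := sum_lines S p; rewrite pS muln1 hS hq.
rewrite (eq_bigr (fun L => #|meet S L| - 2 + 2)); last first.
  move=> L; rewrite in_star => pL.
  by rewrite subnK // (line_ge2 pS pL).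
rewrite big_split /= sum_nat_const card_lines_point hq; lia.
Qed.

Lemma excess_lines_plane p P : p \in S -> incident p P ->
  \sum_(L in pencil (val p) (val P) 1) (#|meet S L| - 2) = #|meet S P| - (q + 2).
Proof.
move=> pS pP; have := sum_lines_plane S pP; rewrite pS muln1 hq.
rewrite (eq_bigr (fun L => #|meet S L| - 2 + 2)); last first.
  move=> L; rewrite in_pencil_sub => /andP[pL _].
  by rewrite subnK // (line_ge2 pS pL).
rewrite big_split /= sum_nat_const card_lines_point_plane // hq; lia.
Qed.

(* The lines through [p] in a plane of size [q + t] already carry the whole
   excess [t - 2] of the star of [p]. *)
Lemma long_line_in_plane p L P : p \in S -> incident p L -> 2 < #|meet S L| ->
  incident p P -> #|meet S P| = q + t -> incident L P.
Proof.
move=> pS pL L3 pP Pt; apply: contraT => LP'.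
have := excess_lines pS; rewrite (bigID [pred X : pgline _ | incident X P]) /=.
rewrite (eq_bigl (mem (pencil (val p) (val P) 1))); last first.
  by move=> X; rewrite in_star -in_pencil_sub.
rewrite excess_lines_plane // Pt (bigD1 L) /=; last first.
  by rewrite in_star pL LP'.
by move: L3; set x := #|meet S L|; clearbody x; lia.
Qed.

(** Two planes of size [q + t] contain [L1], and both must contain [L2]; if the lines differed,
    these planes would coincide. *)
Lemma long_line_unique p L1 L2 : p \in S ->
  incident p L1 -> 2 < #|meet S L1| -> incident p L2 -> 2 < #|meet S L2| ->
  L1 = L2.
Proof.
move=> pS pL1 L1l pL2 L2l; apply/eqP; apply: contraT => neqL.
have [P1 [P2 [neqP]]] := big_plane_pair L1l.
rewrite !inE => /andP[L1P1 /eqP P1t] /andP[L1P2 /eqP P2t].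
have L2P P : incident L1 P -> #|meet S P| = q + t -> incident L2 P.
  move=> L1P; apply: (long_line_in_plane pS pL2 L2l).
  exact: subv_trans pL1 L1P.
by rewrite (plane_of_two_lines neqL L1P1 _ L1P2) ?eqxx ?L2P // in neqP.
Qed.

Lemma long_line_ex p : p \in S ->
  exists2 L : pgline (PG 3 F), incident p L & 2 < #|meet S L|.
Proof.
move=> pS.
have [/existsP[L /andP[pL L3]]|/existsPn none] :=
  boolP [exists L : pgline (PG 3 F), incident p L && (2 < #|meet S L|)].
  by exists L.
have := excess_lines pS; rewrite big1; first by lia.
move=> L; rewrite in_star => pL.
by have := none L; rewrite pL /=; lia.
Qed.

(** By uniqueness, a line with more than 2 points carries the whole excess [t - 2] of its point. *)
Lemma line_card p L : p \in S -> incident p L ->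
  #|meet S L| = 2 \/ #|meet S L| = t.
Proof.
move=> pS pL; have := line_ge2 pS pL; rewrite leq_eqVlt => /orP[/eqP|L3]; auto.
right; have := excess_lines pS; rewrite (bigD1 L) ?in_star //=.
rewrite big1; first by lia.
move=> X /andP[]; rewrite in_star => pX neqX.
apply/eqP; rewrite subn_eq0 leqNgt; apply: contra neqX => X3; apply/eqP.
exact: (long_line_unique pS).
Qed.

Lemma t_line_card1 p : p \in S ->
  #|[set L : pgline (PG 3 F) | incident p L & #|meet S L| == t]| = 1.
Proof.
move=> pS; have [L pL L3] := long_line_ex pS.
apply/eqP/cards1P; exists L; apply/setP=> X; rewrite !inE.
apply/andP/eqP=> [[pX /eqP Xt]|->].
  by apply: (long_line_unique pS) => //; rewrite Xt; lia.
by split=> //; move: L3; case: (line_card pS pL) => ->; rewrite ?eqxx.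
Qed.

Lemma secant_card p : p \in S ->
  #|[set L : pgline (PG 3 F) | incident p L & #|meet S L| == 2]| = q ^ 2 + q.
Proof.
move=> pS; have := card_lines_point p; rewrite hq.
rewrite -(cardsID [set L : pgline (PG 3 F) | #|meet S L| == t] (pencil _ _ _)).
set A := _ :&: _; set B := _ :\: _.
have -> : A = [set L : pgline (PG 3 F) | incident p L & #|meet S L| == t].
  by apply/setP=> L; rewrite in_setI in_star !inE.
have -> : B = [set L : pgline (PG 3 F) | incident p L & #|meet S L| == 2].
  apply/setP=> L; rewrite in_setD in_star !inE andbC; apply: andb_id2l => pL.
  by case: (line_card pS pL) => ->; lia.
by rewrite t_line_card1 //; lia.
Qed.

(** * Planes of size q + 2 and the parity of q *)

Lemma secant_planes L P : #|meet S L| = 2 -> incident L P ->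
  #|meet S P| <> q + t -> #|meet S P| = q + 2.
Proof.
move=> L2 LP; have : 0 < #|meet S L| by rewrite L2.
by move=> /card_plane_on_line/(_ LP) + /eqP/negPf Pt; rewrite Pt muln0 addn0.
Qed.

(** The excesses at [p] inside [P] sum to 0, so each of them vanishes. *)
Lemma small_plane_secant p L P : #|meet S P| = q + 2 -> p \in S ->
  incident p L -> incident L P -> #|meet S L| = 2.
Proof.
move=> P2 pS pL LP; have := excess_lines_plane pS (subv_trans pL LP).
rewrite P2 subnn => /eqP; rewrite sum_nat_eq0 => /forallP/(_ L).
rewrite in_pencil_sub pL LP subn_eq0 /= => L2.
by apply/eqP; rewrite eqn_leq L2 (line_ge2 pS pL).
Qed.

Lemma small_plane_hyperoval P : #|meet S P| = q + 2 -> hyperoval P (meet S P).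
Proof.
move=> P2; split=> [p||x y z]; [by rewrite inE => /andP[] | by rewrite hq |].
rewrite !inE => /andP[xS _] /andP[yS _] /andP[zS _] xy xz yz [L [LP xL yL zL]].
suff : 2 < #|meet S L| by rewrite (small_plane_secant P2 xS xL LP).
have memL p : p \in S -> incident p L -> p \in meet S L.
  by move=> pS pL; rewrite inE pS.
apply/card_gt2P; exists x, y, z; split; first by split; apply: memL.
by split; [exact: xy | exact: yz | rewrite eq_sym; exact: xz].
Qed.

Lemma S_gt0 : exists p, p \in S.
Proof. by apply/card_gt0P; rewrite hS; lia. Qed.

Lemma secant_ex : exists L : pgline (PG 3 F), #|meet S L| = 2.
Proof.
have [p pS] := S_gt0; have := secant_card pS; have := q_gt1 => q1 e.
have /card_gt0P[L] :
  0 < #|[set L : pgline (PG 3 F) | incident p L & #|meet S L| == 2]|.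
  by rewrite e; lia.
by rewrite inE => /andP[_ /eqP]; exists L.
Qed.

Lemma outside_point L : #|meet S L| < q + 1 ->
  exists2 p : pgpoint (PG 3 F), p \notin S & incident p L.
Proof.
move=> Lq.
have : ~~ ([set p : pgpoint (PG 3 F) | incident p L] \subset meet S L).
  apply: contraL Lq => /subset_leq_card.
  by rewrite card_points_line hq leqNgt.
case/subsetPn=> p; rewrite !inE => pL.
by rewrite pL andbT; exists p.
Qed.

(** Only one of the q + 1 planes on a 2-secant has size [q + t]. *)
Lemma small_plane_ex : exists (L : pgline (PG 3 F)) (P : pgplane (PG 3 F)),
  [/\ #|meet S L| = 2, incident L P & #|meet S P| = q + 2].
Proof.
have [L L2] := secant_ex; exists L.
have : ~~ (pencil (val L) fullv 2 \subset big_planes L).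
  apply/negP=> /subset_leq_card; rewrite card_planes_line card_big_planes2 // hq.
  by have := q_gt1; lia.
case/subsetPn=> P; rewrite in_star => LP; rewrite inE negb_and LP /= => /eqP Pt.
exists P; split=> //.
exact: (secant_planes L2 LP Pt).
Qed.

(** The lines of the plane through a point off [S] meet [S] in 0 or 2 points, and these sizes sum to
    q + 2. *)
Lemma q_even : 2 %| q.
Proof.
have [L [P [L2 LP P2]]] := small_plane_ex.
have [|p pS' pL] := @outside_point L; first by have := q_gt1; lia.
have := sum_lines_plane S (subv_trans pL LP).
rewrite (negPf pS') muln0 addn0 P2 => e.
rewrite -(dvdn_addl _ (dvdnn 2)) -e dvdn_sum // => X.
rewrite in_pencil_sub => /andP[pX XP].
have [->|[r]] := set_0Vmem (meet S X); first by rewrite cards0.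
by rewrite inE => /andP[rS rX]; rewrite (small_plane_secant P2 rS rX).
Qed.

Lemma q_pow2 : exists n, 0 < n /\ q = 2 ^ n.
Proof.
have [r rpr rF] := finPcharP F.
have [n qE] : exists n, q = r ^ n.
  by rewrite -hq; eexists; apply: card_pprimeChar rF.
have := q_even; rewrite qE Euclid_dvdX // => /andP[r2 n0].
by exists n; move: r2; rewrite dvdn_prime2 // => /eqP <-.
Qed.

(** * Planes of size q + t as KM-arcs *)

Lemma t_line_in_plane p P : p \in S -> incident p P -> #|meet S P| = q + t ->
  exists L : pgline (PG 3 F), [/\ incident p L, incident L P & #|meet S L| = t].
Proof.
move=> pS pP Pt; have [L pL L3] := long_line_ex pS; exists L; split=> //.
  exact: (long_line_in_plane pS).
by case: (line_card pS pL) => //; lia.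
Qed.

(* The [t]-secants contained in a plane of size [q + t] partition its points
   of [S]. *)
Lemma t_dvd_q : t %| q.
Proof.
have [L0 L2] := secant_ex.
have /card_gt0P[P] : 0 < #|big_planes L0| by rewrite card_big_planes2.
rewrite inE => /andP[_ /eqP Pt].
pose T := [set L : pgline (PG 3 F) | incident L P & #|meet S L| == t].
rewrite -(dvdn_addl _ (dvdnn t)) -Pt -sum1_card.
suff -> : \sum_(p in meet S P) 1 = \sum_(L in T) #|meet S L|.
  by apply: dvdn_sum => L; rewrite inE => /andP[_ /eqP ->].
under [RHS]eq_bigr => L _ do rewrite -sum1_card big_mkcond /=.
rewrite exchange_big /= [LHS]big_mkcond; apply: eq_bigr => p _.
rewrite -big_mkcondr /=.
case: ifP => [|pP']; last first.
  rewrite big_pred0 // => L; apply: contraFF pP' => /andP[].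
  by rewrite inE => /andP[LP _]; apply: (subsetP (meet_incidentS S LP)).
rewrite inE => /andP[pS pP]; have [L [pL LP Lt]] := t_line_in_plane pS pP Pt.
rewrite (big_pred1 L) // => X; rewrite !inE pS /=.
apply/idP/eqP=> [/andP[/andP[_ /eqP Xt] pX]|->]; last by rewrite LP Lt eqxx.
by apply: (long_line_unique pS) => //; rewrite ?Xt ?Lt t_gt2.
Qed.

(** Divisibility excludes t = q + 1, so every t-secant has a point off [S]. *)
Lemma t_le_q : t <= q.
Proof. by apply: dvdn_leq t_dvd_q; have := q_gt1; lia. Qed.

Lemma line_cards L : #|meet S L| \in [:: 0; 2; t].
Proof.
have [->|[r]] := set_0Vmem (meet S L); first by rewrite cards0.
rewrite inE => /andP[rS rL]; rewrite !inE.
by case: (line_card rS rL) => ->; rewrite eqxx ?orbT.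
Qed.

(** Take a point off [S] on a t-secant in [P]. If all q + 1 lines of [P] through it met [S], each
    would do so at least twice, giving 2q + 2 <= q + t. *)
Lemma external_line_ex P : #|meet S P| = q + t ->
  exists2 L : pgline (PG 3 F), incident L P & #|meet S L| = 0.
Proof.
move=> Pt.
have /card_gt0P[p] : 0 < #|meet S P| by rewrite Pt; lia.
rewrite inE => /andP[pS pP].
have [L [pL LP Lt]] := t_line_in_plane pS pP Pt.
have [|r rS' rL] := @outside_point L; first by have := t_le_q; lia.
have rP : incident r P := subv_trans rL LP.
have := sum_lines_plane S rP; rewrite (negPf rS') muln0 addn0 Pt => e.
have [/existsP[X /andP[XP /eqP X0]]|/existsPn none] :=
  boolP [exists X : pgline (PG 3 F), incident X P && (#|meet S X| == 0)].
  by exists X.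
have le2 : (q + 1) * 2 <= q + t.
  rewrite -e -hq -(card_lines_point_plane rP) -sum_nat_const.
  apply: leq_sum => X; rewrite in_pencil_sub => /andP[_ XP].
  have := none X; have := line_cards X; rewrite XP /= mem_seq3.
  by case/or3P=> /eqP-> // _; apply: ltnW t_gt2.
by exfalso; move: le2 t_le_q; clear; lia.
Qed.

Lemma big_plane_KM_arc P : #|meet S P| = q + t -> KM_arc t P (meet S P).
Proof.
move=> Pt; split=> [p||m]; [by rewrite inE => /andP[] | by rewrite hq |].
split=> [[L [LP <-]]|]; first by rewrite meet_meet // line_cards.
have /card_gt0P[p] : 0 < #|meet S P| by rewrite Pt; lia.
rewrite inE => /andP[pS pP].
have [L [pL LP Lt]] := t_line_in_plane pS pP Pt.
rewrite !inE => /or3P[] /eqP->.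
- by have [X XP X0] := external_line_ex Pt; exists X; rewrite meet_meet.
(* Any line of [P] on [p] other than the t-secant [L] is a 2-secant. *)
- have : ~~ (pencil (val p) (val P) 1 \subset [set L]).
    apply/negP=> /subset_leq_card; rewrite card_lines_point_plane // cards1 hq.
    by have := q_gt1; lia.
  case/subsetPn=> X; rewrite in_pencil_sub inE => /andP[pX XP] neqX.
  exists X; rewrite meet_meet //; split=> //.
  case: (line_card pS pX) => // Xt; case/eqP: neqX.
  by apply: (long_line_unique pS) => //; rewrite ?Xt ?Lt t_gt2.
- by exists L; rewrite meet_meet.
Qed.

End TwoPlaneCharacters.

Theorem theorem5p1 (q : nat) (F : finFieldType) (hq : #|F| = q) (t : nat)
    (S : {set pgpoint (PG 3 F)})
    (ht : 2 < t <= q + 1)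
    (hS : #|S| = q ^ 2 + q + t)
    (hplane : forall P : pgplane (PG 3 F),
        #|meet S P| \in [:: 0; q + 2; q + t]) :
  (* (i) *)
  (~ exists L : pgline (PG 3 F), #|meet S L| = 1) /\
  (* (ii) *)
  (forall p : pgpoint (PG 3 F), p \in S ->
     #|[set L : pgline (PG 3 F) | incident p L & #|meet S L| == 2]| = q ^ 2 + q
     /\ #|[set L : pgline (PG 3 F) | incident p L & #|meet S L| == t]| = 1) /\
  (* (iii) *)
  (forall (L : pgline (PG 3 F)) (P : pgplane (PG 3 F)),
     #|meet S L| = t -> incident L P -> #|meet S P| = q + t) /\
  (* (iv) *)
  (forall L : pgline (PG 3 F), #|meet S L| = 2 ->
     #|[set P : pgplane (PG 3 F) | incident L P & #|meet S P| == q + t]| = 1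
     /\ forall P : pgplane (PG 3 F),
          incident L P -> #|meet S P| <> q + t -> #|meet S P| = q + 2) /\
  (* (v) *)
  (forall P : pgplane (PG 3 F), #|meet S P| = q + 2 -> hyperoval P (meet S P)) /\
  (* (vi) *)
  (exists n : nat, 0 < n /\ q = 2 ^ n) /\
  (* (vii) *)
  (forall m : nat,
     (exists L : pgline (PG 3 F), #|meet S L| = m) <-> m \in [:: 0; 2; t]) /\
  (* (viii) *)
  (forall P : pgplane (PG 3 F), #|meet S P| = q + t -> KM_arc t P (meet S P)) /\
  (* (ix) *)
  (forall n : nat, q = 2 ^ n -> exists i : nat, i <= n /\ t = 2 ^ i).
Proof.
split; first by case=> L; apply: (no_tangent hq ht hS hplane).
split; first by move=> p pS; rewrite (secant_card hq ht hS) ?(t_line_card1 hq ht hS).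
split; first exact: (t_line_big hq ht hS hplane).
split.
  move=> L L2; split; first exact: (card_big_planes2 hq ht hS hplane).
  by move=> P; apply: (secant_planes hq ht hS hplane L2).
split; first exact: (small_plane_hyperoval hq ht hS hplane).
split; first exact: (q_pow2 hq ht hS hplane).
split.
  move=> m; split=> [[L <-]|]; first exact: (line_cards hq ht hS hplane).
  (* All three sizes already occur within one plane of size [q + t], found on a 2-secant. *)
  have [L L2] := secant_ex hq ht hS hplane.
  have /card_gt0P[P] := eq_leq (esym (card_big_planes2 hq ht hS hplane L2)).
  rewrite inE => /andP[_ /eqP Pt].
  have [_ _ arc] := big_plane_KM_arc hq ht hS hplane Pt.
  by move/arc=> [X [XP <-]]; exists X; rewrite meet_meet.
split; first exact: (big_plane_KM_arc hq ht hS hplane).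
move=> n qn; have := t_dvd_q hq ht hS hplane.
by rewrite qn => /(dvdn_pfactor _ _ (isT : prime 2)) [i]; exists i.
Qed.
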